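(* Let $\Gamma$ be an $R$-thin connected graph and $n \ge 3$ an integer with $n \neq 4$. Suppose that at least one of $\Gamma$ and $C_n$ is non-bipartite. Then the following statements hold: (a) if $n$ is compatible with $\Gamma$, then $(\Gamma, C_n)$ is nontrivially unstable if and only if at least one $C_n$-automorphism of $\Gamma$ is nondiagonal; (b) if $n \ge 5$ is odd and for every $\{u,v\} \in E(\Gamma^* )$ the set $N_\Gamma(u) \cap N_\Gamma(v)$ is not an independent set of $\Gamma$, then $(\Gamma, C_n)$ is nontrivially unstable if and only if at least one $C_n$-automorphism of $\Gamma$ is nondiagonal.
   Context: All graphs are finite and undirected with no loops or parallel edges. $V(\Gamma)$, $E(\Gamma)$ are the vertex and edge sets, $N_\Gamma(u)$ is the neighbourhood of $u$, $\deg(u)=|N_\Gamma(u)|$, $\mathrm{Aut}(\Gamma)$ is the automorphism group (acting on the right, $u \mapsto u^\sigma$), and $C_n$ is the cycle with $n\ge 3$ vertices. A graph is trivial if it has only one vertex and nontrivial otherwise. The direct product $\Gamma \times \Sigma$ has vertex set $V(\Gamma) \times V(\Sigma)$, with $(u,v)$ and $(x,y)$ adjacent if and only if $\{u,x\}\in E(\Gamma)$ and $\{v,y\}\in E(\Sigma)$. Two graphs $\Gamma,\Sigma$ are coprime if there is no nontrivial graph $\Delta$ such that $\Gamma \cong \Gamma' \times \Delta$ and $\Sigma \cong \Sigma' \times \Delta$ for some graphs $\Gamma', \Sigma'$. A graph $\Gamma$ is $R$-thin if $N_\Gamma(u) \ne N_\Gamma(v)$ for any two distinct vertices $u,v$.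 A graph pair $(\Gamma,\Sigma)$ is stable if $\mathrm{Aut}(\Gamma)\times\mathrm{Aut}(\Sigma)$ is isomorphic to $\mathrm{Aut}(\Gamma\times\Sigma)$, and unstable otherwise. An unstable pair $(\Gamma,\Sigma)$ is nontrivially unstable if $\Gamma$ and $\Sigma$ are $R$-thin connected coprime graphs and at least one of them is non-bipartite. Let $\Sigma$ be a graph with $V(\Sigma)=\{1,\ldots,n\}$. An $n$-tuple $(\alpha_1,\ldots,\alpha_n)$ of permutations of $V(\Gamma)$ is a $\Sigma$-automorphism of $\Gamma$ if for all $u,v\in V(\Gamma)$, $\{u,v\}\in E(\Gamma)$ if and only if $\{u^{\alpha_i},v^{\alpha_j}\}\in E(\Gamma)$, for all $i,j\in V(\Sigma)$ with $\{i,j\}\in E(\Sigma)$. It is nondiagonal if $\alpha_i\neq\alpha_j$ for at least one pair $i,j$ of vertices of $\Sigma$. $\Gamma^*$ is the graph with vertex set $V(\Gamma)$ in which $u,v$ are adjacent if and only if $u \ne v$ and $\deg(u)=\deg(v)=2|N_\Gamma(u)\cap N_\Gamma(v)|$ (degrees in $\Gamma$). For $u\in V(\Gamma)$: if $u$ is isolated in $\Gamma^*$, $L(u)=\{0\}$; if $u$ has degree $1$ in $\Gamma^*$, $L(u)=\{0,1\}$; if $u$ has degree at least $2$ in $\Gamma^*$, $L(u)$ is the (possibly empty) set of lengths of the cycles of $\Gamma^*$ containing $u$. An integer $n\ge3$ is compatible with $\Gamma$ if either (i) $n$ is odd and $n\notin L(u)$ for at least one $u\in V(\Gamma)$, or (ii)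 $n$ is even and $n/2\notin L(u)$ for at least one $u\in V(\Gamma)$.
   Formalization: Γ is additionally assumed nontrivial (more than one vertex): for Γ = K_1 and odd n ≥ 5 the pair (Γ, C_n) is nontrivially unstable, yet every C_n-automorphism of Γ is diagonal, so the statement fails there. *)

(* Defs.v *)
From mathcomp Require Import all_boot fingroup perm morphism gproduct.

Set Implicit Arguments.
Unset Strict Implicit.
Unset Printing Implicit Defensive.

Record sgraph := SGraph {
  vert :> finType;
  adj : rel vert;
  adj_sym : symmetric adj;
  adj_irr : irreflexive adj
}.

Definition nbh (G : sgraph) (u : G) : {set G} := [set v | adj u v].

Definition deg (G : sgraph) (u : G) : nat := #|nbh u|.

Definition nontrivial (G : sgraph) : Prop := #|G| <> 1.

(* The graph with no vertices is not considered connected. *)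
Definition connected (G : sgraph) : Prop :=
  0 < #|G| /\ forall u v : G, connect (@adj G) u v.

Definition bipartite (G : sgraph) : Prop :=
  exists A : {set G}, forall u v : G, adj u v -> (u \in A) != (v \in A).

Definition independent (G : sgraph) (A : {set G}) : Prop :=
  forall u v : G, u \in A -> v \in A -> ~~ adj u v.

Definition r_thin (G : sgraph) : Prop :=
  forall u v : G, u != v -> nbh u != nbh v.

Definition isomorphic (G H : sgraph) : Prop :=
  exists f : G -> H, bijective f /\ forall u v : G, adj (f u) (f v) = adj u v.

Section DirectProduct.
Variables G H : sgraph.

Definition dprod_adj : rel (G * H) := fun p q => adj p.1 q.1 && adj p.2 q.2.

Lemma dprod_sym : symmetric dprod_adj.
Proof. by move=> p q; rewrite /dprod_adj adj_sym (adj_sym p.2). Qed.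

Lemma dprod_irr : irreflexive dprod_adj.
Proof. by move=> p; rewrite /dprod_adj adj_irr. Qed.

Definition direct_product : sgraph := SGraph dprod_sym dprod_irr.

End DirectProduct.

Definition coprime_graphs (G H : sgraph) : Prop :=
  ~ exists D : sgraph,
      [/\ nontrivial D,
          exists G' : sgraph, isomorphic G (direct_product G' D)
        & exists H' : sgraph, isomorphic H (direct_product H' D)].

Section CycleGraph.
Variable n : nat.

(* [i != j] only matters when n = 1, where it removes the loop. *)
Definition cycle_adj : rel 'I_n :=
  fun i j => (i != j) && ((j == ordS i) || (i == ordS j)).

Lemma cycle_sym : symmetric cycle_adj.
Proof. by move=> i j; rewrite /cycle_adj eq_sym orbC. Qed.

Lemma cycle_irr : irreflexive cycle_adj.
Proof. by move=> i; rewrite /cycle_adj eqxx. Qed.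

Definition cycle_graph : sgraph := SGraph cycle_sym cycle_irr.

End CycleGraph.

Section AutomorphismGroup.
Variable G : sgraph.

Definition graph_aut : {set {perm G}} :=
  [set s : {perm G} | [forall u : G, forall v : G,
                         adj (s u) (s v) == adj u v]].

Lemma graph_autP (s : {perm G}) :
  reflect (forall u v : G, adj (s u) (s v) = adj u v) (s \in graph_aut).
Proof.
rewrite inE; apply: (iffP forallP) => [h u v | h u].
  by have /forallP/(_ v)/eqP := h u.
by apply/forallP => v; rewrite h.
Qed.

Lemma graph_aut_group_set : group_set graph_aut.
Proof.
apply/group_setP; split=> [|s t /graph_autP hs /graph_autP ht].
  by apply/graph_autP => u v; rewrite !perm1.
by apply/graph_autP => u v; rewrite !permM ht hs.
Qed.

Canonical graph_aut_group := Group graph_aut_group_set.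

End AutomorphismGroup.

Definition stable (G H : sgraph) : Prop :=
  setX (graph_aut G) (graph_aut H) \isog graph_aut (direct_product G H).

Definition nontrivially_unstable (G H : sgraph) : Prop :=
  ~ stable G H /\
  [/\ r_thin G /\ r_thin H, connected G /\ connected H,
      coprime_graphs G H & ~ bipartite G \/ ~ bipartite H].

(* [alpha] is an H-automorphism of G: one permutation of V(G) per vertex of H. *)
Definition family_automorphism (H G : sgraph) (alpha : H -> {perm G}) : Prop :=
  forall i j : H, adj i j ->
  forall u v : G, adj u v <-> adj (alpha i u) (alpha j v).

Definition nondiagonal (H G : sgraph) (alpha : H -> {perm G}) : Prop :=
  exists i j : H, alpha i <> alpha j.

(* [star G] is the graph G^*; [deg] and [nbh] below are those of G. *)
Section Star.
Variable G : sgraph.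

Definition star_adj : rel G := fun u v =>
  [&& u != v, deg u == deg v & deg v == 2 * #|nbh u :&: nbh v|].

Lemma star_sym : symmetric star_adj.
Proof.
move=> u v; rewrite /star_adj eq_sym setIC [deg v == deg u]eq_sym.
by case: (deg u =P deg v) => [->|].
Qed.

Lemma star_irr : irreflexive star_adj.
Proof. by move=> u; rewrite /star_adj eqxx. Qed.

Definition star : sgraph := SGraph star_sym star_irr.

End Star.

Definition cycle_through (G : sgraph) (u : G) (k : nat) : Prop :=
  exists c : seq G, [/\ ucycle (@adj G) c, 3 <= size c, u \in c & size c = k].

(* The set L(u), as a predicate on nat; degrees and cycles are those of [star G]. *)
Definition cycle_lengths (G : sgraph) (u : G) (k : nat) : Prop :=
  match deg (G := star G) u with
  | 0 => k = 0
  | 1 => k = 0 \/ k = 1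
  | _ => cycle_through (G := star G) u k
  end.

Definition compatible (n : nat) (G : sgraph) : Prop :=
  (odd n /\ exists u : G, ~ cycle_lengths u n) \/
  (~~ odd n /\ exists u : G, ~ cycle_lengths u n./2).

(* Main.v *)
From mathcomp Require Import all_boot fingroup perm morphism gproduct zify.
Require Import Defs.

Set Implicit Arguments.
Unset Strict Implicit.
Unset Printing Implicit Defensive.

(** The star of the product of [G] with the cycle, in which two vertices are
    joined when their degrees agree and half of their neighbours are common, is
    the Cartesian product of the star of [G] with the graph joining vertices of
    the cycle at distance two ([star_productP]). Automorphisms of the direct
    product preserve its star. Call layers the orbits of the map [shift] taking
    [(u, i)] to [(u, i + 2)]; they are cycles of the star. The image of an edge
    of a layer is either again an edge of a layer, and the edge is then called
    straight, or an edge of the star of [G] inside one fibre. The two kinds do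
    not mix along a layer: three consecutive vertices of a layer have no common
    neighbour, but the vertices of a corner made of an edge of each kind have
    one ([straight_shift]).

    One straight edge determines the shape of the automorphism. The common
    neighbours of [(u, i)] and [(u, i + 2)] are the [(w, i + 1)] with [w]
    adjacent to [u], so the layers through these are straight too and are
    traversed in the same direction; as the product is connected, by Weichsel's
    theorem, the second coordinate of the image of [(w, j)] is a function of [j]
    alone ([follows_fibres]).

    If there were no straight edge, every layer would be mapped to a cycle of
    the star of [G] through a prescribed vertex, of length [n] or [n / 2], against
    compatibility ([not_straight_cycle]). In the second case, the common
    neighbours of [x] and [shift x] lie in one fibre, so that a walk of odd
    length between two of them has length at least [n]; but an edge inside a
    common neighbourhood in [G] yields one of length [n - 2] between the
    corresponding vertices of the image ([straight_of_dependent]).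

    Hence all automorphisms permute the fibres. Each then amounts to an
    automorphism of the cycle together with a family of permutations of [G]
    indexed by the cycle, which is a pair of automorphisms exactly when the
    family is diagonal. Coprimality follows as well, because exchanging the two
    copies of a common factor would be an automorphism that breaks fibres
    ([preserves_fibres_coprime]). *)


(** * Connectivity, walks and automorphisms *)

Lemma connected_ind (G : sgraph) (B : pred G) (x y : G) :
  connected G -> (forall u v : G, adj u v -> B u -> B v) -> B x -> B y.
Proof.
move=> [_ cG] stepB Bx; have /connectP[p] := cG x y.
elim: p x Bx => [x Bx _ -> //|z p IHp x Bx /= /andP[xz pz]].
exact: IHp (stepB _ _ xz Bx) pz.
Qed.

Lemma connected_nbr (G : sgraph) (u : G) :
  connected G -> nontrivial G -> exists v : G, adj u v.
Proof.
move=> cG ntG; apply/existsP; apply: contraT => /existsPn noN; case: ntG.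
rewrite -(card1 u); apply: eq_card => v; rewrite !inE; apply/esym.
apply: (@connected_ind G (pred1 u) u v cG) => [x y xy /eqP xu|]; last exact: eqxx.
by move: (noN y); rewrite -xu xy.
Qed.

Lemma nbh_card_gt0 (G : sgraph) (u : G) :
  connected G -> nontrivial G -> 0 < #|nbh u|.
Proof.
move=> cG ntG; have [v uv] := connected_nbr u cG ntG.
by apply/card_gt0P; exists v; rewrite inE.
Qed.

Fixpoint walk (G : sgraph) (k : nat) (u v : G) : Prop :=
  if k is k'.+1 then exists2 w : G, adj u w & walk k' w v else u = v.

Lemma walk_morph (G H : sgraph) (f : G -> H) (k : nat) (u v : G) :
  {homo f : x y / adj x y} -> walk k u v -> walk k (f u) (f v).
Proof.
move=> hf; elim: k u => [|k IHk] u /= => [-> // | [w uw wv]].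
by exists (f w); [apply: hf | apply: IHk].
Qed.

Lemma walk_product (G H : sgraph) (k : nat) (x y : direct_product G H) :
  walk k x.1 y.1 -> walk k x.2 y.2 -> walk k x y.
Proof.
elim: k x => [|k IHk] [u i] /= => [|[w uw wy1] [j ij jy2]].
  by case: y => v j /= -> ->.
by exists (w, j); [apply/andP | apply: IHk].
Qed.

(** Walking back and forth along an edge. *)
Lemma walk_edge_odd (G : sgraph) (k : nat) (u v : G) :
  adj u v -> odd k -> walk k u v.
Proof.
move=> uv; elim/ltn_ind: k => -[//|[|k]] IHk /= ok; first by exists v.
by exists v => //; exists u; [rewrite adj_sym | apply: IHk; move: ok; rewrite /= negbK].
Qed.

Lemma graph_aut_adj (G : sgraph) (s : {perm G}) (u v : G) :
  s \in graph_aut G -> adj (s u) (s v) = adj u v.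
Proof. by move/graph_autP. Qed.

Lemma graph_aut_nbh (G : sgraph) (s : {perm G}) (u : G) :
  s \in graph_aut G -> nbh (s u) = s @: nbh u.
Proof.
move=> sA; apply/setP => v; rewrite -(permKV s v) mem_imset; last exact: perm_inj.
by rewrite !inE graph_aut_adj.
Qed.

Lemma graph_aut_star (G : sgraph) (s : {perm G}) (u v : G) :
  s \in graph_aut G -> star_adj (s u) (s v) = star_adj u v.
Proof.
move=> sA; rewrite /star_adj /deg !graph_aut_nbh // (inj_eq perm_inj).
by rewrite -imsetI ?card_imset //; try exact: perm_inj; move=> ? ? _ _; apply: perm_inj.
Qed.

Lemma star_common_nbr (G : sgraph) (u v : G) :
  connected G -> nontrivial G -> star_adj u v ->
  exists w : G, adj u w && adj v w.
Proof.
move=> cG ntG /and3P[_ _ /eqP dv].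
have : 0 < deg v by exact: nbh_card_gt0.
rewrite dv muln_gt0 /= => /card_gt0P[w]; rewrite !inE => uvw; by exists w.
Qed.

(** A vertex on a cycle has two neighbours on it, so its degree selects the last
    clause of [cycle_lengths]. *)
Lemma cycle_through_lengths (G : sgraph) (u : G) (k : nat) :
  cycle_through (G := star G) u k -> cycle_lengths u k.
Proof.
move=> cyc; suff : 1 < deg (G := star G) u.
  by rewrite /cycle_lengths; case: deg => [|[|d]].
have [c [/andP[cc uc] c3 /rot_to[i c' ec] _]] := cyc.
have {}cc : path.cycle (@star_adj G) (u :: c') by rewrite -ec rot_cycle.
have {}uc : uniq (u :: c') by rewrite -ec rot_uniq.
have {}c3 : 3 <= size (u :: c') by rewrite -ec size_rot.
case: c' cc uc c3 {ec} => [//|v [//|w c']] /= /andP[uv].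
rewrite rcons_path => /and3P[_ _ lu] /and3P[_ vwc _] _.
apply/card_gt1P; exists v, (last w c'); rewrite !inE.
by rewrite /= uv star_sym lu; split=> //; apply: contraNneq vwc => ->; rewrite mem_last.
Qed.

Lemma mkseq_ucycle (T : eqType) (e : rel T) (f : nat -> T) (m : nat) :
  (forall k, e (f k) (f k.+1)) -> f m = f 0 ->
  {in gtn m &, injective f} -> ucycle e (mkseq f m).
Proof.
move=> ef fm f_inj; apply/andP; split; last exact/mkseq_uniqP.
case: m fm {f_inj} => [//|m] fm; rewrite /mkseq /=.
have -> : rcons [seq f i | i <- iota 1 m] (f 0) = [seq f i | i <- iota 1 m.+1].
  by rewrite -(addn1 m) iotaD map_cat cats1 add1n -fm.
have pathf a k : path e (f a) [seq f i | i <- iota a.+1 k].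
  by elim: k a => //= k IHk a; rewrite ef IHk.
exact: pathf.
Qed.

(** Weichsel's theorem: in the factor with an odd closed walk one can reach any
    vertex by walks of either parity, while the other factor goes back and
    forth along an edge. *)
Lemma connect_over_edge (G H : sgraph) (x : G) (y y' : H) :
  connected G -> ~ bipartite G -> adj y y' ->
  forall (z : G) (b : bool),
  connect (@adj (direct_product G H)) (x, y) (z, if b then y' else y).
Proof.
move=> cG nbG yy'; pose pt b := if b then y' else y.
set R := fun z b => connect (@adj (direct_product G H)) (x, y) (z, pt b).
have stepR z z' b : adj z z' -> R z b -> R z' (~~ b).
  move=> zz' Rz; apply: connect_trans Rz (connect1 _).
  by rewrite /= /dprod_adj /= zz'; case: b => /=; rewrite ?yy' // adj_sym.
have [z /andP[Rzt Rzf]] : exists z, R z true && R z false.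
  apply/existsP; apply: contraT => /existsPn nR; case: nbG.
  exists [set z | R z false] => u v uv; rewrite !inE.
  have Ruv : R u true || R u false.
    apply: (@connected_ind G (fun u => R u true || R u false) x) => //.
      by move=> a b /stepR ab /orP[]/ab ->; rewrite ?orbT.
    by apply/orP; right; apply: connect0.
  have := nR v; have := nR u; have := stepR _ _ true uv.
  have := stepR _ _ false uv; move: Ruv.
  case: (R u true); case: (R u false); case: (R v true); case: (R v false) => //=;
    by do ?[move/(_ isT)].
move=> w b; suff : R w true && R w false by case/andP; case: b.
apply: (@connected_ind G (fun u => R u true && R u false) z) => //; last exact/andP.
by move=> u v uv /andP[/(stepR _ _ _ uv) -> /(stepR _ _ _ uv) ->].
Qed.

Lemma product_connected (G H : sgraph) :
  connected G -> nontrivial G -> connected H -> nontrivial H ->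
  ~ bipartite G \/ ~ bipartite H -> connected (direct_product G H).
Proof.
move=> cG ntG cH ntH nb; split.
  by rewrite card_prod muln_gt0 cG.1 cH.1.
case: nb => [nbG [x y] [x' y']|nbH [x y] [x' y']].
  apply: (@connected_ind H
    (fun z => connect (@adj (direct_product G H)) (x, y) (x', z)) y) => //.
    move=> u v uv; move/connect_trans; apply.
    exact: (connect_over_edge x' cG nbG uv x' true).
  have [y1 yy1] := connected_nbr y cH ntH.
  exact: (connect_over_edge x cG nbG yy1 x' false).
pose P := direct_product H G.
have sw a b a' b' : connect (@adj P) (b, a) (b', a') ->
    connect (@adj (direct_product G H)) (a, b) (a', b').
  case/connectP => p; elim: p a b => [|[d c] p IHp] a b /=.
    by move=> _ [-> ->]; apply: connect0.
  case/andP => /andP[/= bd ac] cp /(IHp _ _ cp).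
  by apply: connect_trans (connect1 _); rewrite /= /dprod_adj /= ac.
apply: (@connected_ind G
  (fun z => connect (@adj (direct_product G H)) (x, y) (z, y')) x) => //.
  move=> u v uv; move/connect_trans; apply; apply: sw.
  exact: (connect_over_edge y' cH nbH uv y' true).
have [x1 xx1] := connected_nbr x cG ntG; apply: sw.
exact: (connect_over_edge y cH nbH xx1 y' false).
Qed.


(** * The cycle *)

Section Cycle.
Variable n : nat.
Hypotheses (n_ge3 : 3 <= n) (n_neq4 : n <> 4).
Local Notation C := (cycle_graph n).

Lemma iter_ordS (k : nat) (i : 'I_n) : iter k (@ordS n) i = (i + k) %% n :> nat.
Proof.
elim: k => [|k IHk] /=; first by rewrite addn0 modn_small.
by rewrite IHk -addn1 modnDml addn1 addnS.
Qed.

Lemma iter_ordS_eq (k : nat) (i : 'I_n) : (iter k (@ordS n) i == i) = (n %| k).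
Proof.
rewrite -val_eqE /= iter_ordS -[X in _ == X](modn_small (ltn_ord i)).
by rewrite -[in X in _ == X](addn0 i) eqn_modDl mod0n.
Qed.

(** An automorphism of the product may reverse the cycle, so the facts on two
    consecutive steps are needed in both directions. *)
Definition direction (r : 'I_n -> 'I_n) : Prop := r = @ordS n \/ r = @ord_pred n.

Lemma iter_direction_eq (r : 'I_n -> 'I_n) (k : nat) (i : 'I_n) :
  direction r -> (iter k r i == i) = (n %| k).
Proof.
case=> ->; first exact: iter_ordS_eq.
have ordSK_iter j : iter k (@ordS n) (iter k (@ord_pred n) j) = j.
  by elim: k j => // k IHk j; rewrite iterSr iterS ord_predK IHk.
rewrite -(iter_ordS_eq k i); apply/eqP/eqP => [fix_i | fix_i].
  by rewrite -[in LHS]fix_i ordSK_iter.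
have iterS_inj : injective (iter k (@ordS n)).
  by elim: (k) => // k' IHk' a b /ordS_inj/IHk'.
by apply: iterS_inj; rewrite ordSK_iter fix_i.
Qed.

Lemma direction_inj (r : 'I_n -> 'I_n) : direction r -> injective r.
Proof. by case=> ->; [apply: ordS_inj | apply: can_inj (@ord_predK n)]. Qed.

Lemma direction2_neq (r : 'I_n -> 'I_n) (i : 'I_n) : direction r -> r (r i) != i.
Proof. by move=> dr; rewrite (iter_direction_eq 2 i dr) gtnNdvd. Qed.

Lemma direction4_neq (r : 'I_n -> 'I_n) (i : 'I_n) :
  direction r -> r (r (r (r i))) != i.
Proof.
move=> dr; rewrite (iter_direction_eq 4 i dr).
by case: n n_ge3 n_neq4 => [|[|[|[|[|m]]]]] // _ _; rewrite gtnNdvd.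
Qed.

Lemma direction_adjE (r : 'I_n -> 'I_n) (i j : C) :
  direction r -> adj i j = (j == r i) || (i == r j).
Proof.
have adjS (a b : C) : adj a b = (b == ordS a) || (a == ordS b).
  rewrite /= /cycle_adj; case: eqP => [->|//] /=.
  by rewrite orbb eq_sym (iter_ordS_eq 1) gtnNdvd // (leq_trans _ n_ge3).
case=> ->; rewrite adjS // orbC.
by rewrite ![_ == ord_pred _]eq_sym !(can2_eq (@ord_predK n) (@ordSK n)).
Qed.

Lemma cycle_nontrivial : nontrivial C.
Proof. by rewrite /nontrivial card_ord => n1; have := n_ge3; rewrite n1. Qed.

Lemma cycle_connected : connected C.
Proof.
split=> [|i j]; first by rewrite card_ord (leq_trans _ n_ge3).
have -> : j = iter (j + n - i) (@ordS n) i.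
  apply: val_inj; rewrite /= iter_ordS subnKC ?modnDr ?modn_small //.
  by rewrite (leq_trans (ltnW (ltn_ord i))) ?leq_addl.
elim: (j + n - i) => [|k IHk]; first exact: connect0.
apply: connect_trans IHk (connect1 _).
by rewrite (direction_adjE _ _ (or_introl erefl)) eqxx.
Qed.

Lemma cycle_nbh (i : C) : nbh i = [set (ordS i : C); (ord_pred i : C)].
Proof.
apply/setP => j; rewrite !inE (direction_adjE i j (or_introl erefl)).
by rewrite [j == ord_pred i]eq_sym (can2_eq (@ord_predK n) (@ordSK n)).
Qed.

Lemma cycle_deg (i : C) : deg i = 2.
Proof.
rewrite /deg cycle_nbh cards2 -(inj_eq (@ordS_inj n)) ord_predK.
by rewrite (direction2_neq i (or_introl erefl)).
Qed.

(** Since the length is not 4, going on from [i] does not lead to a second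
    common neighbour. *)
Lemma common_nbr_direction2 (r : 'I_n -> 'I_n) (i k : C) :
  direction r -> adj i k -> adj (r (r i) : C) k -> k = r i.
Proof.
move=> dr; rewrite !(direction_adjE _ _ dr) => /orP[/eqP //|/eqP ik].
case/orP => /eqP; last by move/(direction_inj dr).
by rewrite ik => /esym/eqP; rewrite (negPf (direction4_neq k dr)).
Qed.

Lemma common_nbr_direction (r : 'I_n -> 'I_n) (i j k : C) :
  direction r -> i != j -> adj i k -> adj j k -> j = r (r i) \/ i = r (r j).
Proof.
move=> dr ij; rewrite !(direction_adjE _ _ dr) => /orP[]/eqP ik /orP[]/eqP jk.
- by move: ij; rewrite (direction_inj dr (etrans (esym ik) jk)) eqxx.
- by left; rewrite jk ik.
- by right; rewrite ik jk.
by move: ij; rewrite ik jk eqxx.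
Qed.

Lemma cycle_r_thin : r_thin C.
Proof.
move=> i j ij; apply/eqP => /setP Nij; have dS : direction (@ordS n) by left.
have Ni k : adj i k = adj j k by have := Nij k; rewrite !inE.
have iS : adj i (ordS i : C) by rewrite (direction_adjE _ _ dS) eqxx.
have jS : adj j (ordS j : C) by rewrite (direction_adjE _ _ dS) eqxx.
have [ej|ei] := common_nbr_direction dS ij iS (etrans (esym (Ni _)) iS).
  have := common_nbr_direction2 dS (etrans (Ni _) jS).
  rewrite -ej => /(_ jS)/(direction_inj dS) eij.
  by move: ij; rewrite eij eqxx.
rewrite eq_sym in ij.
have := common_nbr_direction2 dS (etrans (esym (Ni _)) iS).
rewrite -ei => /(_ iS)/(direction_inj dS) eij.
by move: ij; rewrite eij eqxx.
Qed.

Lemma cycle_common_nbrs (i j : C) : i != j -> #|nbh i :&: nbh j| <= 1.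
Proof.
move=> ij; rewrite leqNgt; apply: contraNN (cycle_r_thin ij) => c2.
have sub (a b : C) : 1 < #|nbh a :&: nbh b| -> nbh a \subset nbh b.
  move=> c; apply/setIidPl/eqP; rewrite eqEcard subsetIl.
  by rewrite (leq_trans _ c) // -/(deg a) cycle_deg.
by rewrite eqEsubset !sub // setIC.
Qed.

(** A walk of length [k] takes [a] steps in one direction and [b] in the
    other. *)
Lemma cycle_walk_split (k : nat) (i j : C) :
  walk k i j -> exists a b : nat, a + b = k /\ i + a = j + b %[mod n].
Proof.
elim: k i => [|k IHk] i; first by move=> ->; exists 0, 0.
case=> l il /IHk[a [b [<- lab]]].
move: il; rewrite (direction_adjE i l (or_introl erefl)) => /orP[]/eqP e.
  by exists a.+1, b; rewrite -lab e /= modnDml addSnnS addnS -addSnnS.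
exists a, b.+1; split; first by rewrite addnS.
by rewrite e /= modnDml addnS addSn -addn1 -modnDml lab modnDml addn1.
Qed.

Lemma odd_closed_walk (k : nat) (i : C) : walk k i i -> odd k -> n <= k.
Proof.
case/cycle_walk_split => a [b [<- /eqP]]; rewrite eqn_modDl => /eqP ab oab.
rewrite leqNgt; apply/negP => lt_n; move: ab oab.
rewrite !modn_small ?(leq_ltn_trans _ lt_n) ?leq_addr ?leq_addl // => ->.
by rewrite addnn odd_double.
Qed.

Lemma walk_around (j : C) : walk (n - 2) (ord_pred j : C) (ordS j).
Proof.
have dP : direction (@ord_pred n) by right.
have walkP k (i : C) : walk k i (iter k (@ord_pred n) i).
  elim: k i => // k IHk i; exists (ord_pred i : C).
    by rewrite (direction_adjE _ _ dP) eqxx.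
  by rewrite iterSr.
suff -> : ordS j = iter (n - 2) (@ord_pred n) (ord_pred j) by [].
apply: (direction_inj dP); rewrite ordSK -iterSr -iterS.
have -> : (n - 2).+2 = n by rewrite -addn2 subnK // ltnW.
by apply/esym/eqP; rewrite (iter_direction_eq _ _ dP).
Qed.

End Cycle.


(** * Automorphisms of the product with a cycle *)

Lemma product_nbh (G H : sgraph) (u : G) (i : H) :
  nbh ((u, i) : direct_product G H) = setX (nbh u) (nbh i).
Proof. by apply/setP => -[v j]; rewrite !inE. Qed.

Lemma setXI (T1 T2 : finType) (A1 B1 : {set T1}) (A2 B2 : {set T2}) :
  setX A1 A2 :&: setX B1 B2 = setX (A1 :&: B1) (A2 :&: B2).
Proof. by apply/setP => -[x y]; rewrite !inE /= andbACA. Qed.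

Section CycleProduct.
Variables (G : sgraph) (n : nat).
Hypotheses (thinG : r_thin G) (cG : connected G) (ntG : nontrivial G).
Hypotheses (n_ge3 : 3 <= n) (n_neq4 : n <> 4).
Local Notation C := (cycle_graph n).
Local Notation P := (direct_product G C).

Definition shift (x : P) : P := (x.1, ordS (ordS x.2)).

Lemma star_shift (x : P) : star_adj x (shift x).
Proof.
case: x => u i; rewrite /star_adj /deg /shift !product_nbh setXI !cardsX setIid.
rewrite -!/(deg _) !(cycle_deg n_ge3) eqxx /=; apply/andP; split.
  by rewrite xpair_eqE eqxx eq_sym (direction2_neq n_ge3 _ (or_introl erefl)).
suff -> : #|nbh (i : C) :&: nbh (ordS (ordS i) : C)| = 1 by rewrite muln1 mulnC.
apply/eqP; rewrite eqn_leq (cycle_common_nbrs n_ge3 n_neq4) /=; last first.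
  by rewrite eq_sym (direction2_neq n_ge3 _ (or_introl erefl)).
apply/card_gt0P; exists (ordS i : C).
by rewrite !inE !(direction_adjE n_ge3 _ _ (or_introl erefl)) !eqxx orbT.
Qed.

(** The star of the product is the Cartesian product of the star of [G] and of
    the graph joining the vertices of the cycle at distance two: vertices in
    different fibres have half of the neighbours in common only when their
    first coordinates have all their neighbours in common, which [r_thin]
    forbids unless these coordinates agree. *)
Lemma star_productP (r : 'I_n -> 'I_n) (x y : P) :
  direction r -> star_adj x y ->
  x.2 = y.2 /\ star_adj x.1 y.1 \/
  x.1 = y.1 /\ (y.2 = r (r x.2) \/ x.2 = r (r y.2)).
Proof.
move=> dr; case: x y => u i [v j].
rewrite /star_adj /deg !product_nbh setXI !cardsX -!/(deg _) !(cycle_deg n_ge3) /=.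
rewrite eqn_pmul2r // => /and3P[neq /eqP duv].
have dv : 0 < deg v by apply: nbh_card_gt0.
have [eij|ij] := eqVneq i j.
  rewrite -eij setIid -/(deg i) (cycle_deg n_ge3) mulnA eqn_pmul2r // => dv2.
  left; split=> //; rewrite duv eqxx dv2 !andbT.
  by apply: contraNneq neq => ->; rewrite eij.
have := cycle_common_nbrs n_ge3 n_neq4 ij; rewrite leq_eqVlt ltnS leqn0.
case/orP=> /eqP c; rewrite c => /eqP duv2; last by move: dv; lia.
have {}duv2 : #|nbh u :&: nbh v| = deg v by lia.
have euv : u = v.
  apply/eqP; apply: contraT => /thinG /eqP; case.
  have /eqP <- : nbh u :&: nbh v == nbh u by rewrite eqEcard subsetIl duv2 -duv /=.
  by apply/eqP; rewrite eqEcard subsetIr duv2 /=.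
have : 0 < #|nbh i :&: nbh j| by rewrite c.
case/card_gt0P => k; rewrite !inE => /andP[ik jk]; right; split=> //.
exact: (common_nbr_direction n_ge3 dr ij ik jk).
Qed.

Lemma shift3_no_common_nbr (x z : P) :
  adj x z -> adj (shift x) z -> adj (shift (shift x)) z -> False.
Proof.
have dS : direction (@ordS n) by left.
case: x z => u i [w k] /andP[_ ik] /andP[_ iik] /andP[_ i4k].
have ek := common_nbr_direction2 n_ge3 n_neq4 dS ik iik.
have := common_nbr_direction2 n_ge3 n_neq4 dS iik i4k.
rewrite ek => /(direction_inj dS)/esym/eqP.
by rewrite (negPf (direction2_neq n_ge3 _ dS)).
Qed.

Lemma star_corner_common_nbr (H : sgraph) (u v : G) (i j k : H) :
  star_adj u v -> adj i k -> adj j k ->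
  exists z : direct_product G H, [/\ adj ((u, i) : direct_product G H) z,
    adj ((v, i) : direct_product G H) z & adj ((v, j) : direct_product G H) z].
Proof.
move=> /(star_common_nbr cG ntG)[w /andP[uw vw]] ik jk.
by exists (w, k); split; apply/andP.
Qed.

Section Automorphism.
Variable phi : {perm P}.
Hypothesis phiA : phi \in graph_aut P.

Definition straight (x : P) : bool := (phi (shift x)).1 == (phi x).1.

Lemma straightP (r : 'I_n -> 'I_n) (x : P) : direction r -> straight x ->
  (phi (shift x)).2 = r (r (phi x).2) \/ (phi x).2 = r (r (phi (shift x)).2).
Proof.
move=> dr /eqP st.
have := star_productP dr (etrans (graph_aut_star _ _ phiA) (star_shift x)).
by case=> [[_]|[_ //]]; rewrite st star_irr.
Qed.

Lemma not_straightP (x : P) : ~~ straight x ->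
  (phi x).2 = (phi (shift x)).2 /\ star_adj (phi x).1 (phi (shift x)).1.
Proof.
move=> nst; have dS : direction (@ordS n) by left.
have := star_productP dS (etrans (graph_aut_star _ _ phiA) (star_shift x)).
by case=> [//|[e _]]; case/eqP: nst.
Qed.

Lemma straight_common_nbr (x : P) : straight x ->
  exists k : C, adj (phi x).2 k && adj (phi (shift x)).2 k.
Proof.
have dS : direction (@ordS n) by left.
case/(straightP dS) => ->.
  exists (ordS (phi x).2).
  by rewrite !(direction_adjE n_ge3 _ _ dS) !eqxx orbT.
exists (ordS (phi (shift x)).2).
by rewrite !(direction_adjE n_ge3 _ _ dS) !eqxx orbT.
Qed.

(** Otherwise two consecutive edges of a layer would be mapped to a corner made
    of an edge of each kind: the ends of the corner and its middle vertex have a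
    common neighbour, contrary to [shift3_no_common_nbr]. *)
Lemma straight_shift (x : P) : straight (shift x) = straight x.
Proof.
have no_corner z : adj (phi x) z -> adj (phi (shift x)) z ->
    adj (phi (shift (shift x))) z -> False.
  rewrite -(permKV phi z) !(graph_aut_adj _ _ phiA); exact: shift3_no_common_nbr.
case: (boolP (straight x)) => st1; case: (boolP (straight (shift x))) => st2 //.
  have [e s] := not_straightP st2; rewrite star_sym in s.
  have [k /andP[k1 k2]] := straight_common_nbr st1.
  rewrite e in k2; have [z] := star_corner_common_nbr s k2 k1.
  rewrite -[in X in [/\ _, X & _]]e [in X in [/\ _, _ & X]](eqP st1).
  by rewrite -!surjective_pairing; case=> z3 z2 z1; case: (no_corner z).
have [e s] := not_straightP st1.
have [k /andP[k1 k2]] := straight_common_nbr st2.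
rewrite -e in k1; have [z] := star_corner_common_nbr s k1 k2.
rewrite [in X in [/\ _, X & _]]e -[in X in [/\ _, _ & X]](eqP st2).
by rewrite -!surjective_pairing; case=> z1 z2 z3; case: (no_corner z).
Qed.

Lemma straight_iter (k : nat) (x : P) : straight (iter k shift x) = straight x.
Proof. by elim: k => // k IHk; rewrite iterS straight_shift. Qed.

Lemma iter_shift (k : nat) (x : P) :
  iter k shift x = (x.1, iter k.*2 (@ordS n) x.2).
Proof.
elim: k => [|k IHk]; first exact: surjective_pairing.
by rewrite iterS IHk.
Qed.

(** The layer of [x] has no straight edge, so its image stays in one fibre; the
    length of a layer is the additive order of 2 modulo [n]. *)
Lemma not_straight_cycle (x : P) (m : nat) :
  ~~ straight x -> m = (if odd n then n else n./2) -> 3 <= m ->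
  cycle_through (G := star G) (phi x).1 m.
Proof.
move=> nst em m3; pose f k := (phi (iter k shift x)).1.
have nstk k : ~~ straight (iter k shift x) by rewrite straight_iter.
have f2 k : (phi (iter k shift x)).2 = (phi x).2.
  by elim: k => // k <-; have [] := not_straightP (nstk k).
have shift_per k l : k < m -> l < m -> iter k shift x = iter l shift x -> k = l.
  move=> km lm; rewrite !iter_shift => -[] /(congr1 val) /eqP.
  rewrite /= !iter_ordS eqn_modDl => /eqP kl.
  case: (boolP (odd n)) em => [on|en] em; last first.
    by move: kl; rewrite !modn_small; lia.
  have ck : coprime 2 n by rewrite coprime2n.
  wlog lk : k l km lm kl / l <= k.
    by case: (leqP l k) => [lk|/ltnW kl'] h; [apply: h | apply/esym/h].
  have /eqP := kl; rewrite eqn_mod_dvd ?leq_double // -doubleB -mul2n.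
  rewrite Gauss_dvdr ?(coprime_sym n) // => /dvdn_leq; lia.
exists (mkseq f m); rewrite size_mkseq; split=> //; last first.
  by apply/mapP; exists 0 => //; rewrite mem_iota; lia.
apply: mkseq_ucycle.
- by move=> k; have [] := not_straightP (nstk k).
- have mS : iter m shift x = x.
    rewrite iter_shift [RHS]surjective_pairing; congr (_, _); apply/eqP.
    rewrite iter_ordS_eq em; case: (boolP (odd n)) => [on|en].
      by rewrite -muln2 dvdn_mulr.
    by rewrite even_halfK // dvdnn.
  by rewrite /f mS.
move=> k l; rewrite !inE => km lm fkl; apply: shift_per => //.
apply: (@perm_inj _ phi); rewrite [LHS]surjective_pairing [RHS]surjective_pairing.
by rewrite !f2; congr (_, _).
Qed.

(** The common neighbours of [x] and [shift x] lie in one fibre, so an odd walk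
    between two of them has length at least [n]. If the images of [x] and
    [shift x] lay in one fibre, an edge [a b] in the common neighbourhood of
    their first coordinates would give an odd walk of length [n - 2] between two
    of their common neighbours: it alternates between [a] and [b] while the
    second coordinate goes around the cycle the long way. *)
Lemma straight_of_dependent (x : P) :
  odd n ->
  (forall u v : G, star_adj u v -> ~ independent (nbh u :&: nbh v)) ->
  straight x.
Proof.
move=> on indep; apply: contraT => /not_straightP[e s].
exfalso; apply: indep s _ => a b; rewrite !inE => /andP[ua va] /andP[ub vb].
apply/negP => ab; have dS : direction (@ordS n) by left.
set j := (phi x).2 in e.
have aj1 : adj j (ord_pred j : C).
  by rewrite (direction_adjE n_ge3 _ _ dS) ord_predK eqxx orbT.
have aj2 : adj j (ordS j : C) by rewrite (direction_adjE n_ge3 _ _ dS) eqxx.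
pose y : P := (a, (ord_pred j : C)); pose z : P := (b, (ordS j : C)).
have phiV : (phi^-1)%g \in graph_aut P by rewrite groupV.
have mid (p : P) : adj (phi x) p -> adj (phi (shift x)) p ->
    ((phi^-1)%g p).2 = ordS x.2.
  rewrite -{1 2}(permKV phi p) !(graph_aut_adj _ _ phiA) => /andP[_ h1] /andP[_ h2].
  exact: (common_nbr_direction2 n_ge3 n_neq4 dS h1 h2).
have ey : ((phi^-1)%g y).2 = ordS x.2 by apply: mid; apply/andP; split; rewrite //= -?e.
have ez : ((phi^-1)%g z).2 = ordS x.2 by apply: mid; apply/andP; split; rewrite //= -?e.
have wyz : walk (n - 2) y z.
  apply: walk_product; last exact: (walk_around n_ge3).
  by apply: walk_edge_odd => //; rewrite oddB ?on // ltnW.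
have homV : {homo (phi^-1)%g : p q / adj p q}.
  by move=> p q; rewrite (graph_aut_adj _ _ phiV).
have hom2 : {homo (fun p : P => p.2) : p q / adj p q} by move=> p q /andP[].
have := walk_morph hom2 (walk_morph homV wyz).
rewrite /= ey ez => /(odd_closed_walk n_ge3).
rewrite oddB ?on ?(ltnW n_ge3) // => /(_ isT).
by move: n_ge3; lia.
Qed.

(** [phi] maps the layer through [x], locally at [x], to the layer traversed in
    the direction [r]. *)
Definition follows (r : 'I_n -> 'I_n) (x : P) : Prop :=
  phi (shift x) = ((phi x).1, r (r (phi x).2)).

Lemma straight_follows (x : P) :
  straight x -> exists2 r : 'I_n -> 'I_n, direction r & follows r x.
Proof.
move=> st; have dS : direction (@ordS n) by left.
have [e|e] := straightP dS st.
  exists (@ordS n) => //; rewrite /follows -e -(eqP st); exact: surjective_pairing.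
exists (@ord_pred n); first by right.
by rewrite /follows e !ordSK -(eqP st); apply: surjective_pairing.
Qed.

Lemma follows_shift (r : 'I_n -> 'I_n) (x : P) :
  direction r -> follows r x -> follows r (shift x).
Proof.
move=> dr fx; have st : straight (shift x).
  by rewrite straight_shift /straight fx.
rewrite /follows; have [e|e] := straightP dr st.
  by rewrite -e -(eqP st); apply: surjective_pairing.
(* otherwise the image of the layer would turn back *)
have : phi (shift (shift x)) = phi x.
  rewrite [LHS]surjective_pairing (eqP st) fx [RHS]surjective_pairing; congr (_, _).
  by move: e; rewrite fx => /(direction_inj dr)/(direction_inj dr).
move/perm_inj; case: x {fx st e} => u i [/eqP].
by rewrite (negPf (direction4_neq n_ge3 n_neq4 i (or_introl erefl))).
Qed.

(** The neighbours of [x] one step ahead are common neighbours of [x] and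
    [shift x], so their images lie half way between those of [x] and
    [shift x]. *)
Lemma follows_adj (r : 'I_n -> 'I_n) (x : P) (w : G) :
  direction r -> follows r x -> adj x.1 w ->
  follows r (w, ordS x.2) /\ (phi (w, ordS x.2)).2 = r (phi x).2.
Proof.
move=> dr fx xw; have dS : direction (@ordS n) by left.
have between (y : P) : follows r y -> y.1 = x.1 ->
    (phi (w, ordS y.2)).2 = r (phi y).2.
  move=> fy ey; rewrite -ey in xw.
  have a1 : adj (phi y) (phi (w, ordS y.2)).
    rewrite (graph_aut_adj _ _ phiA); apply/andP; split=> //.
    by rewrite (direction_adjE n_ge3 _ _ dS) eqxx.
  have a2 : adj (phi (shift y)) (phi (w, ordS y.2)).
    rewrite (graph_aut_adj _ _ phiA); apply/andP; split=> //.
    by rewrite (direction_adjE n_ge3 _ _ dS) eqxx orbT.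
  rewrite fy in a2; case/andP: a1 a2 => _ a1 /andP[_ a2].
  exact: (common_nbr_direction2 n_ge3 n_neq4 dr a1 a2).
have b1 := between x fx erefl.
have b2 := between (shift x) (follows_shift dr fx) erefl.
rewrite fx /= in b2; split=> //.
have st : straight (w, ordS x.2).
  apply: contraT => /not_straightP[e _]; move: e.
  rewrite /shift /= b1 b2 => /(direction_inj dr)/esym/eqP.
  by rewrite (negPf (direction2_neq n_ge3 _ dr)).
rewrite /follows b1 -(eqP st) [LHS]surjective_pairing; congr (_, _); exact: b2.
Qed.

(** [sigma] is the rotation or reflection of the cycle that agrees with [phi] at
    [x0]. The agreement spreads to the neighbours one step ahead by
    [follows_adj], and to those one step behind because going back in the cycle
    amounts to going around it. *)
Lemma follows_fibres (r : 'I_n -> 'I_n) (x0 : P) :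
  connected P -> direction r -> follows r x0 ->
  forall (u v : G) (j : C), (phi (u, j)).2 = (phi (v, j)).2.
Proof.
move=> cP dr fx0.
have [a [la ea]] : exists a : nat, a < n /\ a = x0.2 by exists x0.2; rewrite ltn_ord.
pose sigma (j : 'I_n) := iter (j + n - a) r (phi x0).2.
have iter_n k b : iter (k + n) r b = iter k r b.
  rewrite iterD; congr iter; apply/eqP; by rewrite (iter_direction_eq _ _ dr).
have sigmaS j : sigma (ordS j) = r (sigma j).
  have lj := ltn_ord j.
  rewrite /sigma /= -iterS; have [j1|j1] : j.+1 < n \/ j.+1 = n by lia.
    by rewrite modn_small //; congr iter; lia.
  by rewrite j1 modnn add0n -[in LHS]iter_n; congr iter; lia.
pose B x := (phi (shift x) == ((phi x).1, r (r (phi x).2))) &&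
            ((phi x).2 == sigma x.2).
have B_forward (x : P) w : adj x.1 w -> B x -> B (w, ordS x.2).
  move=> xw /andP[/eqP fx /eqP sx]; have [f e] := follows_adj dr fx xw.
  by apply/andP; split; apply/eqP; rewrite // e sx sigmaS.
have B_shift x : B x -> B (shift x).
  have [w xw] := connected_nbr x.1 cG ntG => Bx.
  by have := B_forward _ _ _ (B_forward _ _ xw Bx); apply; rewrite adj_sym.
have B_adj (x y : P) : adj x y -> B x -> B y.
  case: x y => u i [v j] /andP[/= uv ij] Bx.
  have By := B_forward (u, i) v uv Bx; rewrite /= in By.
  have : @adj C i j by [].
  rewrite (direction_adjE n_ge3 _ _ (or_introl erefl)) => /orP[/eqP -> //|/eqP eij].
  suff -> : (v, j) = iter n.-1 shift (v, ordS i) :> P.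
    by elim: n.-1 => // k; rewrite iterS; apply: B_shift.
  rewrite iter_shift /=; congr (_, _); rewrite eij -[ordS (ordS j)]/(iter 2 (@ordS n) j).
  rewrite -iterD; apply/esym/eqP; rewrite iter_ordS_eq.
  have -> : (n.-1).*2 + 2 = n.*2 by lia.
  by rewrite -muln2 dvdn_mulr.
have Bx0 : B x0.
  apply/andP; split; first exact/eqP.
  apply/eqP; rewrite /sigma ea addnC addnK.
  exact: (esym (iter_n 0 _)).
have Bx x : B x by exact: (@connected_ind P B x0 x cP).
move=> u v j; have /andP[_ /eqP ->] := Bx (u, j).
by have /andP[_ /eqP ->] := Bx (v, j).
Qed.

End Automorphism.
End CycleProduct.


(** * Automorphisms preserving the fibres of a product *)

Section Fibres.
Variables G H : sgraph.
Local Notation P := (direct_product G H).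

Definition preserves_fibres : Prop :=
  forall phi : {perm P}, phi \in graph_aut P ->
  forall (u v : G) (j : H), (phi (u, j)).2 = (phi (v, j)).2.

(** Exchanging the two copies of a common factor is an automorphism of the
    product that mixes the fibres. *)
Lemma preserves_fibres_coprime :
  0 < #|G| -> 0 < #|H| -> preserves_fibres -> coprime_graphs G H.
Proof.
move=> /card_gt0P[u _] /card_gt0P[j _] fibres [D [ntD]].
move=> [G' [f [bij_f fA]]] [H' [h [bij_h hA]]].
case: bij_f => f' fK f'K; case: bij_h => h' hK h'K.
pose swap (x : P) : P :=
  (f' ((f x.1).1, (h x.2).2), h' ((h x.2).1, (f x.1).2)).
have swapK : involutive swap.
  by case=> a b; rewrite /swap /= f'K h'K /= -!surjective_pairing fK hK.
have swapA : perm (can_inj swapK) \in graph_aut P.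
  have f'A a b : adj (f' a) (f' b) = adj a b by rewrite -fA !f'K.
  have h'A a b : adj (h' a) (h' b) = adj a b by rewrite -hA !h'K.
  apply/graph_autP => -[a b] [a' b']; rewrite !permE /= /dprod_adj /= f'A h'A.
  by rewrite -fA -hA /= /dprod_adj /= andbACA [X in _ && X]andbC andbACA.
case: ntD; apply/eqP/fintype1P; exists (f u).2 => d.
pose u' := f' ((f u).1, d).
have := fibres _ swapA u u' j; rewrite !permE /= f'K /=.
by move/(can_inj h'K) => [].
Qed.

Definition pair_map (s : {perm G} * {perm H}) (x : P) : P := (s.1 x.1, s.2 x.2).

Lemma pair_map_inj (s : {perm G} * {perm H}) : injective (pair_map s).
Proof. by move=> [u i] [v j] [/perm_inj -> /perm_inj ->]. Qed.

Definition pair_perm (s : {perm G} * {perm H}) : {perm P} :=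
  perm (@pair_map_inj s).

Lemma pair_permM : {morph pair_perm : s t / (s * t)%g >-> (s * t)%g}.
Proof. by move=> s t; apply/permP => x; rewrite permM !permE /pair_map /= !permM. Qed.

Lemma pair_perm_inj : 0 < #|G| -> 0 < #|H| -> injective pair_perm.
Proof.
move=> /card_gt0P[u0 _] /card_gt0P[j0 _] [s1 s2] [t1 t2] st.
congr (_, _); apply/permP; [move=> u | move=> j].
  by have /permP/(_ (u, j0)) := st; rewrite !permE => -[].
by have /permP/(_ (u0, j)) := st; rewrite !permE => -[].
Qed.

Lemma pair_perm_aut (s : {perm G} * {perm H}) :
  s \in setX (graph_aut G) (graph_aut H) -> pair_perm s \in graph_aut P.
Proof.
rewrite inE => /andP[/graph_autP s1 /graph_autP s2]; apply/graph_autP => x y.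
by rewrite !permE /= /dprod_adj /= s1 s2.
Qed.

(** Pairs of automorphisms embed in the automorphism group of the
    product; as the groups are finite, an isomorphism exists exactly when this
    embedding is onto. *)
Lemma stableP : 0 < #|G| -> 0 < #|H| ->
  stable G H <->
  graph_aut P \subset pair_perm @: setX (graph_aut G) (graph_aut H).
Proof.
move=> G0 H0; set X := setX _ _.
have sub : pair_perm @: X \subset graph_aut P.
  by apply/subsetP => _ /imsetP[s sX ->]; apply: pair_perm_aut.
have cardX : #|pair_perm @: X| = #|X| by apply: card_imset; apply: pair_perm_inj.
split=> [/card_isog eqc | onto].
  by have /eqP -> : pair_perm @: X == graph_aut P by rewrite eqEcard sub cardX eqc /=.
apply/isogP; exists (Morphism (in2W pair_permM) : {morphism X >-> _}).
  by apply/injmP => s t _ _; apply: pair_perm_inj.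
rewrite morphimEdom; apply/eqP; rewrite eqEsubset; apply/andP; split.
  exact: sub.
exact: onto.
Qed.

(** Over a fibre-preserving automorphism of the product lie an automorphism of
    [H], acting on the fibres, and the permutations of [G] that it induces from
    fibre to fibre. *)
Lemma fibred_automorphism (phi : {perm P}) (a b : G) :
  preserves_fibres -> adj a b -> phi \in graph_aut P ->
  exists (alpha : H -> {perm G}) (sigma : {perm H}),
  [/\ family_automorphism alpha, sigma \in graph_aut H
    & forall x : P, phi x = (alpha x.2 x.1, sigma x.2)].
Proof.
move=> fibres ab phiA; pose beta j u := (phi (u, j)).1.
pose tau j := (phi (a, j)).2.
have phiE u j : phi (u, j) = (beta j u, tau j).
  by rewrite [LHS]surjective_pairing (fibres _ phiA u a).
have beta_inj j : injective (beta j).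
  move=> u v e; have /perm_inj[//] : phi (u, j) = phi (v, j).
  by rewrite !phiE e.
pose alpha j := perm (@beta_inj j).
have phi_alpha u j : phi (u, j) = (alpha j u, tau j) by rewrite phiE permE.
have tau_inj : injective tau.
  move=> i j e; have /perm_inj[//] :
      phi ((alpha i)^-1 a, i)%g = phi ((alpha j)^-1 a, j)%g.
  by rewrite !phi_alpha !permKV e.
have phi_adj u v i j :
    adj (alpha i u) (alpha j v) && adj (tau i) (tau j) = adj u v && adj i j.
  have := @graph_aut_adj P phi (u, i) (v, j) phiA; rewrite !phi_alpha; exact.
have tauA i j : adj (tau i) (tau j) = adj i j.
  case ij: (adj i j); first by have := phi_adj a b i j; rewrite ab ij => /andP[].
  have := phi_adj ((alpha i)^-1 a)%g ((alpha j)^-1 b)%g i j.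
  by rewrite !permKV ab ij andbF.
exists alpha, (perm tau_inj); split=> [i j ij u v||[u j]].
- by have := phi_adj u v i j; rewrite tauA ij !andbT => ->.
- by apply/graph_autP => i j; rewrite !permE.
by rewrite phi_alpha permE.
Qed.

(** The automorphism of the product attached to a family is not a pair of
    automorphisms when the family is nondiagonal. *)
Lemma nondiagonal_unstable (alpha : H -> {perm G}) :
  0 < #|G| -> family_automorphism alpha -> nondiagonal alpha -> ~ stable G H.
Proof.
move=> G0 alphaA [i [j aij]] st.
have H0 : 0 < #|H| by apply/card_gt0P; exists i.
pose f (x : P) : P := (alpha x.2 x.1, x.2).
have f_inj : injective f by move=> [u k] [v l] [] /[swap] -> /perm_inj ->.
have fA : perm f_inj \in graph_aut P.
  apply/graph_autP => -[u k] [v l]; rewrite !permE /= /dprod_adj /=.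
  case kl: (adj k l); rewrite ?andbF // !andbT.
  by have e := alphaA k l kl u v; apply/idP/idP => /e.
have /subsetP/(_ _ fA)/imsetP[s _ es] := (stableP G0 H0).1 st.
have alphaE k u : alpha k u = s.1 u.
  by have /permP/(_ (u, k)) := es; rewrite !permE => -[].
by apply: aij; apply/permP => u; rewrite !alphaE.
Qed.

Lemma unstable_nondiagonal (a b : G) (i j : H) :
  preserves_fibres -> adj a b -> adj i j -> ~ stable G H ->
  exists alpha : H -> {perm G}, family_automorphism alpha /\ nondiagonal alpha.
Proof.
move=> fibres ab ij nst.
have G0 : 0 < #|G| by apply/card_gt0P; exists a.
have H0 : 0 < #|H| by apply/card_gt0P; exists i.
have /subsetPn[phi phiA /negP nphi] :
    ~~ (graph_aut P \subset pair_perm @: setX (graph_aut G) (graph_aut H)).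
  by apply/negP => /(stableP G0 H0).
have [alpha [sigma [alphaA sigmaA phiE]]] := fibred_automorphism fibres ab phiA.
case: (boolP [forall k, alpha k == alpha i]) => [/forallP diag | /forallPn[k /eqP ne]].
  case: nphi; apply/imsetP; exists (alpha i, sigma).
    rewrite inE sigmaA andbT; apply/graph_autP => u v.
    have := alphaA i j ij u v; rewrite (eqP (diag j)) => e.
    by apply/idP/idP => /e.
  by apply/permP => x; rewrite phiE permE /pair_map /= (eqP (diag x.2)).
by exists alpha; split=> //; exists k, i.
Qed.

End Fibres.


(** * Stability of pairs involving a cycle *)

Lemma compatible_straight (G : sgraph) (n : nat)
    (phi : {perm direct_product G (cycle_graph n)}) :
  r_thin G -> connected G -> nontrivial G -> 3 <= n -> n <> 4 ->
  compatible n G -> phi \in graph_aut (direct_product G (cycle_graph n)) ->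
  exists x, straight phi x.
Proof.
move=> thinG cG ntG n3 n4 compat phiA.
pose m := if odd n then n else n./2.
have [u nLu] : exists u : G, ~ cycle_lengths u m.
  by rewrite /m; case: compat => -[par [u nLu]]; exists u; move: nLu;
    [rewrite par | rewrite (negPf par)].
have m3 : 3 <= m by rewrite /m; case: ifP => // en; lia.
have [i _] := card_gt0P (cycle_connected n3).1.
(* the layer whose image passes through a vertex lying on no [m]-cycle of the star *)
exists ((phi^-1)%g (u, i)); apply: contraT => nst; case: nLu.
apply: cycle_through_lengths.
have := not_straight_cycle thinG cG ntG n3 n4 phiA nst erefl m3.
by rewrite permKV.
Qed.

(** Connectivity of the product spreads the effect of one straight edge over
    all fibres. *)
Lemma cycle_unstableP (G : sgraph) (n : nat) :
  r_thin G -> connected G -> nontrivial G -> 3 <= n -> n <> 4 ->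
  ~ bipartite G \/ ~ bipartite (cycle_graph n) ->
  (forall phi : {perm direct_product G (cycle_graph n)},
     phi \in graph_aut (direct_product G (cycle_graph n)) ->
     exists x, straight phi x) ->
  nontrivially_unstable G (cycle_graph n) <->
  exists alpha : cycle_graph n -> {perm G},
    family_automorphism alpha /\ nondiagonal alpha.
Proof.
move=> thinG cG ntG n3 n4 nb st.
have cC := cycle_connected n3; have ntC := cycle_nontrivial n3.
have cP := product_connected cG ntG cC ntC nb.
have fibres : preserves_fibres G (cycle_graph n).
  move=> phi phiA; have [x stx] := st phi phiA.
  have [r dr fx] := straight_follows thinG cG ntG n3 n4 phiA stx.
  exact: (follows_fibres thinG cG ntG n3 n4 phiA cP dr fx).
have [a _] := card_gt0P cG.1; have [i _] := card_gt0P cC.1.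
split=> [[nst _] | [alpha [alphaA alphaN]]].
  have [b ab] := connected_nbr a cG ntG; have [j ij] := connected_nbr i cC ntC.
  exact: (unstable_nondiagonal fibres ab ij nst).
split; first exact: (nondiagonal_unstable cG.1 alphaA alphaN).
split=> //; first by split=> //; apply: cycle_r_thin.
exact: (preserves_fibres_coprime cG.1 cC.1 fibres).
Qed.

Theorem theorem1p2 (G : sgraph) (n : nat)
    (hG : r_thin G) (cG : connected G) (ntG : nontrivial G)
    (n_ge3 : 3 <= n) (n_neq4 : n <> 4)
    (nbip : ~ bipartite G \/ ~ bipartite (cycle_graph n)) :
  (compatible n G ->
     (nontrivially_unstable G (cycle_graph n) <->
      exists alpha : cycle_graph n -> {perm G},
        family_automorphism alpha /\ nondiagonal alpha))
  /\
  (5 <= n -> odd n ->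
   (forall u v : G, @adj (star G) u v -> ~ independent (nbh u :&: nbh v)) ->
     (nontrivially_unstable G (cycle_graph n) <->
      exists alpha : cycle_graph n -> {perm G},
        family_automorphism alpha /\ nondiagonal alpha)).
Proof.
split=> [compat | _ on dep]; apply: cycle_unstableP => // phi phiA.
  exact: compatible_straight phiA.
have [u _] := card_gt0P cG.1.
have [i _] := card_gt0P (cycle_connected n_ge3).1.
by exists (u, i); apply: (straight_of_dependent hG cG ntG n_ge3 n_neq4 phiA).
Qed.
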